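(* Let $F=(F_N)_{N\in\mathbb{N}}$ be a sequence of finite nonempty subsets of a group $G$, let $(X,\mathcal{B},\mu,(T_g)_{g\in G})$ be a measure preserving system and let $Y\in\mathcal{B}$. Suppose that $$0<\delta:=\limsup_{N\to\infty}\frac{1}{|F_N|}\sum_{g\in F_N}\mu\left(T_{g}^{-1}Y\cap T_{g}Y\right)=\limsup_{N\to\infty}\frac{1}{|F_N|}\sum_{g\in F_N}\mu\left(Y\cap T_{g}^2Y\right).$$ Then there exists $B\subseteq G$ such that $\overline{d}_F(B)\geq\delta$ and $$BB\subseteq\left\{g\in G:\mu\left(Y\cap T_{g}Y\right)>0\right\}.$$
   Context: A measure preserving system $(X,\mathcal{B},\mu,(T_g)_{g\in G})$ consists of a probability space $(X,\mathcal{B},\mu)$ and a left action $(T_g)_{g\in G}$ of $G$ on $X$ by measure-preserving maps, so that $T_{gh}=T_g\circ T_h$. For $E\subseteq G$, $\overline{d}_F(E)=\limsup_{N\to\infty}\frac{|E\cap F_N|}{|F_N|}$. $BB=\{bb':b,b'\in B\}$. *)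

(* Defs.v *)
From HB Require Import structures.
From mathcomp Require Import all_boot all_order all_algebra finmap.
From mathcomp Require Import all_classical all_reals all_analysis.

Set Implicit Arguments.
Unset Strict Implicit.
Unset Printing Implicit Defensive.

Import Order.TTheory GRing.Theory Num.Theory.
Import numFieldNormedType.Exports.

Local Open Scope classical_set_scope.
Local Open Scope ring_scope.

Record measure_preserving_action (G : groupType) (R : realType)
    (d : measure_display) (X : measurableType d) (mu : probability X R)
    (T : G -> X -> X) : Prop := MeasurePreservingAction {
  mpa_measurable : forall g, measurable_fun setT (T g) ;
  mpa_preserving : forall g A, measurable A -> mu (T g @^-1` A) = mu A ;
  mpa_1 : T 1%g = id ;
  mpa_M : forall g h, T (g * h)%g = T g \o T h }.

Definition average (G : choiceType) (R : realType) (A : {fset G})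
    (f : G -> \bar R) : \bar R :=
  (((#|` A|%fset)%:R^-1)%:E * \sum_(g <- A) f g)%E.

Definition upper_density (G : choiceType) (R : realType) (F : nat -> {fset G})
    (E : set G) : \bar R :=
  limn_esup (fun N =>
    (#|` [fset g in F N | g \in E]%fset|%:R / #|` F N|%:R)%:E : \bar R).

(* Main.v *)
Require Import Defs.
From HB Require Import structures.
From mathcomp Require Import all_boot all_order all_algebra finmap.
From mathcomp Require Import all_classical all_reals all_analysis measurable_realfun.

Set Implicit Arguments.
Unset Strict Implicit.
Unset Printing Implicit Defensive.

Import Order.TTheory GRing.Theory Num.Theory.
Import numFieldNormedType.Exports.

Local Open Scope classical_set_scope.
Local Open Scope ring_scope.

(** The set [B] is a set of return times of a single well-chosen point.  For a
point [x], let [B_x] consist of the [g] in the union of the [F N] such that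
[x] lies in [T_g^-1 Y] and in [T_g Y].  Two facts make [B_x] work for some
[x].

Products.  If [b, b'] are in [B_x], then [x] witnesses that the intersection of
[T_b^-1 Y] and [T_b' Y] is nonempty, and this intersection has the same
measure as that of [Y] and [T_(bb') Y], because [T_b] preserves the measure
([measure_action_split]).  A nonempty set may be null, but only countably many
pairs [(b, b')] are involved, since the union of the finite sets [F N] is
countable.  Hence almost every [x] avoids all the null intersections
([ae_forall_countable]), and for such an [x] the product set of [B_x] is
contained in the required set.

Density.  The proportion of [F N] lying in [B_x], as a function of [x], is the
average over [g] in [F N] of the indicators of the sets
[T_g^-1 Y] inter [T_g Y]; its integral is the average whose limit superior is
[delta].  By the reverse Fatou inequality ([limn_esup_integral_le]) the
integral over [x] of the upper density of [B_x] is at least [delta], so the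
upper density is at least [delta] on a set of positive measure, which contains
a point of the conull set above ([exists_ge_integral]). *)

(** * Almost everywhere properties and integrals *)

(** An injection of the index set into [nat] reduces this to sequences of
properties. *)
Lemma ae_forall_countable d (X : sigmaRingType d) (R : realType)
    (mu : {measure set X -> \bar R}) (I : Type) (D : set I)
    (P : I -> X -> Prop) :
  countable D -> (forall i, D i -> \forall x \ae mu, P i x) ->
  \forall x \ae mu, forall i, D i -> P i x.
Proof.
move=> /countable_injP[f finj] aeP.
have /ae_foralln : forall n, \forall x \ae mu, forall i, D i -> f i = n -> P i x.
  move=> n; have [[i [Di fin]]|noi] := pselect (exists i, D i /\ f i = n).
    apply: filterS (aeP i Di) => x Pix j Dj fjn.
    by have <- : i = j by apply: finj; rewrite ?inE// fin fjn.
  by apply: aeW => x i Di fin; case: noi; exists i.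
by apply: filterS => x Px i Di; exact: (Px (f i) i).
Qed.

(** The first moment method, with the point chosen in a prescribed conull set:
if [g] were below its mean [c] almost everywhere, then [c - g] would be
positive almost everywhere with integral [0]. *)
Lemma exists_ge_integral d (X : measurableType d) (R : realType)
    (mu : probability X R) (g : X -> \bar R) (Q : X -> Prop) :
  mu.-integrable setT g -> (\forall x \ae mu, Q x) ->
  exists x, Q x /\ (\int[mu]_x g x <= g x)%E.
Proof.
move=> ig aeQ; apply: contrapT => noQ.
have gfin : (\int[mu]_x g x)%E \is a fin_num by exact: integrable_fin_num.
set c := (fine (\int[mu]_x g x)%E).
have cE : (\int[mu]_x g x)%E = c%:E by rewrite fineK.
pose h x : \bar R := (c%:E - g x)%E.
have ic : mu.-integrable setT (EFin \o cst c) by exact: finite_measure_integrable_cst.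
have mh : measurable_fun setT h.
  by apply: emeasurable_funB => //; exact: measurable_int ig.
have h_gt0 : \forall x \ae mu, (0 < h x)%E.
  apply: filterS aeQ => x Qx; rewrite /h sube_gt0 ltNge -cE; apply/negP => gx.
  by apply: noQ; exists x.
have : (\int[mu]_x `|h x| = 0)%E.
  rewrite (ae_eq_integral h) //.
  - rewrite /h (integralB measurableT ic ig) cE /=.
    rewrite (integral_cst mu measurableT c%:E) /=.
    by rewrite probability_setT mule1 subee.
  - exact: measurableT_comp.
  - by apply: filterS h_gt0 => x hx _; rewrite gte0_abs.
move/(ae_eq_integral_abs mu measurableT mh) => h0.
have : \forall x \ae mu, False.
  by apply: filterS2 h0 h_gt0 => x /(_ I) ->; rewrite ltxx.
move=> aeF.
have /(negligibleP _ measurableT) : mu.-negligible [set: X].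
  by rewrite -setC0; exact: aeF.
by rewrite /= probability_setT => /eqP; rewrite onee_eq0.
Qed.

(** The reverse Fatou inequality.  The tail suprema [esups (f ^~ x) n] converge
to the limit superior and stay below [M], so their integrals converge by
dominated convergence; each of these integrals dominates all the integrals of
[f k] for [k >= n]. *)
Lemma limn_esup_integral_le d (X : measurableType d) (R : realType)
    (mu : {finite_measure set X -> \bar R}) (f : nat -> X -> \bar R) (M : R) :
  (forall n, measurable_fun setT (f n)) ->
  (forall n x, (0 <= f n x <= M%:E)%E) ->
  mu.-integrable setT (fun x => limn_esup (f ^~ x)) /\
  (limn_esup (fun n => \int[mu]_x f n x) <=
    \int[mu]_x limn_esup (f ^~ x))%E.
Proof.
move=> mf f0M.
have f_le n x : (f n x <= esups (f ^~ x) n)%E.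
  by apply: ereal_sup_ubound; exists n => /=.
have esups_ge0 n x : (0 <= esups (f ^~ x) n)%E.
  by apply: le_trans (f_le n x); have /andP[] := f0M n x.
have mesups n : measurable_fun setT (fun x => esups (f ^~ x) n).
  exact: measurable_fun_esups.
have [|||||ig _ cvg_int] := @dominated_convergence _ _ _ mu setT measurableT
    (fun n x => esups (f ^~ x) n) (fun x => limn_esup (f ^~ x)) (EFin \o cst M).
- exact: mesups.
- exact: measurable_fun_limn_esup.
- by apply: aeW => x _; rewrite limn_esup_lim; exact: is_cvg_esups.
- exact: finite_measure_integrable_cst.
- apply: aeW => x n _ /=; rewrite gee0_abs//.
  by apply: ge_ereal_sup => _ [k _ <-]; have /andP[] := f0M k x.
split=> //; rewrite -(cvg_lim _ cvg_int)// limn_esup_lim.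
apply: lee_lim; first exact: is_cvg_esups.
  by apply/cvg_ex; eexists; exact: cvg_int.
apply: nearW => n; apply: ge_ereal_sup => _ [k /= nk <-].
apply: ge0_le_integral => //.
- by move=> x _; have /andP[] := f0M k x.
- by move=> x _; apply: ereal_sup_ubound; exists k.
Qed.

(** * Averages of indicator functions *)

(** This is what turns the upper density of the set of all [g] with [x \in S g]
into the limit superior of a sequence of functions of [x]. *)
Lemma average_indic (G : choiceType) (R : realType) (A : {fset G}) (X : Type)
    (S : G -> set X) (x : X) :
  average A (fun g => (\1_(S g) x)%:E) =
  (#|` [fset g in A | x \in S g]%fset|%:R / #|` A|%:R)%:E :> \bar R.
Proof.
rewrite /average sumEFin -EFinM mulrC; congr (_ / _)%:E.
rewrite card_fset_sum1 natr_sum -big_fset_condE/= [RHS]big_mkcond/=.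
by apply: eq_bigr => g _; rewrite indicE; case: (x \in S g).
Qed.

Lemma integral_average (G : choiceType) (R : realType) d (X : measurableType d)
    (mu : {measure set X -> \bar R}) (A : {fset G}) (f : G -> X -> \bar R) :
  (forall g, measurable_fun setT (f g)) -> (forall g x, 0 <= f g x)%E ->
  (\int[mu]_x average A (f ^~ x) = average A (fun g => \int[mu]_x f g x))%E.
Proof.
move=> mf f0; rewrite ge0_integralZl_EFin//.
- by rewrite ge0_integral_sum.
- by move=> x _; exact: sume_ge0.
- exact: emeasurable_sum.
Qed.

(** * Measure preserving actions *)

Section action.
Context (R : realType) (G : groupType) (d : measure_display)
  (X : measurableType d) (mu : probability X R) (T : G -> X -> X)
  (actT : measure_preserving_action mu T).

(** Since [T_g] is invertible, images under the action are preimages, and so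
inherit measurability. *)
Lemma action_image (g : G) (A : set X) : T g @` A = T g^-1%g @^-1` A.
Proof.
have TK h x : T h (T h^-1%g x) = x.
  by rewrite -[LHS]/((T h \o T h^-1%g) x) -(mpa_M actT) mulgV (mpa_1 actT).
apply/seteqP; split=> [_ [y Ay <-]|x Ax] /=.
  by rewrite -{2}(invgK g) in TK *; have := TK g^-1%g y; rewrite invgK => ->.
by exists (T g^-1%g x).
Qed.

Lemma measurable_action_preimage (g : G) (A : set X) :
  measurable A -> measurable (T g @^-1` A).
Proof. by move=> mA; rewrite -[_ @^-1` _]setTI; exact: (mpa_measurable actT). Qed.

Lemma measurable_action_image (g : G) (A : set X) :
  measurable A -> measurable (T g @` A).
Proof. by rewrite action_image; exact: measurable_action_preimage. Qed.

(** Pulling back by [T_g] carries [T_(gh) Y = T_g (T_h Y)] to [T_h Y]. *)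
Lemma measure_action_split (g h : G) (Y : set X) : measurable Y ->
  mu (Y `&` T (g * h)%g @` Y) = mu (T g @^-1` Y `&` T h @` Y).
Proof.
move=> mY.
rewrite -(mpa_preserving actT g (measurableI _ _ mY (measurable_action_image _ mY))).
congr (mu _); rewrite preimage_setI; congr (_ `&` _).
by rewrite !action_image -comp_preimage -(mpa_M actT) invgM -mulgA mulVg mulg1.
Qed.
End action.

Theorem theorem1p24 (R : realType) (G : groupType) (F : nat -> {fset G})
    (F_neq0 : forall N, F N <> fset0)
    (d : measure_display) (X : measurableType d) (mu : probability X R)
    (T : G -> X -> X) (actT : measure_preserving_action mu T)
    (Y : set X) (mY : measurable Y) (delta : \bar R)
    (delta_gt0 : (0 < delta)%E)
    (deltaE : delta = limn_esup (fun N =>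
       average (F N) (fun g => mu (T g @^-1` Y `&` T g @` Y))))
    (deltaE' : delta = limn_esup (fun N =>
       average (F N) (fun g => mu (Y `&` (T g \o T g) @` Y)))) :
  exists B : set G,
    (delta <= upper_density R F B)%E /\
    [set (b * b')%g | b in B & b' in B] `<=`
      [set g : G | (0 < mu (Y `&` T g @` Y))%E].
Proof.
(* Restricting to the union of the [F N] leaves the density unchanged and makes
   the set of pairs of group elements countable. *)
pose D := \bigcup_N [set` F N].
have cD : countable D by apply: bigcup_countable => // N _; exact: countable_fset.
pose meet p := T p.1 @^-1` Y `&` T p.2 @` Y.
have mmeet p : measurable (meet p).
  by apply: measurableI; [exact: (measurable_action_preimage actT)
                         |exact: (measurable_action_image actT)].
have ae_meet : \forall x \ae mu, forall p, (D `*` D) p ->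
    meet p x -> (0 < mu (meet p))%E.
  apply: ae_forall_countable; first exact: countableX.
  move=> p _; have [p0|p_neq0] := eqVneq (mu (meet p)) 0%E.
    exists (meet p); split => // x /= /not_implyP[] //.
  by apply: aeW => x _; rewrite lt0e p_neq0 measure_ge0.
pose S g := meet (g, g).
have mS g : measurable (S g) by exact: mmeet.
pose f N x : \bar R := average (F N) (fun g => (\1_(S g) x)%:E).
have mindic g : measurable_fun setT (fun x => (\1_(S g) x)%:E : \bar R).
  by apply/measurable_EFinP; exact: measurable_indic.
have mf N : measurable_fun setT (f N).
  by apply: measurable_funeM; exact: emeasurable_sum.
have f01 N x : (0 <= f N x <= 1%:E)%E.
  rewrite /f average_indic !lee_fin divr_ge0//= ler_pdivrMr.
    by rewrite mul1r ler_nat fsubset_leq_card//; exact: fset_sub.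
  by rewrite ltr0n cardfs_gt0; apply/eqP.
have [iL intL] := limn_esup_integral_le mu mf f01.
(* The point [x] has upper density of return times at least the mean, and lies
   in no null set [meet (b, b')] with [b] and [b'] in [D]. *)
have [x [meetx deltax]] := exists_ge_integral iL ae_meet.
exists [set g | D g /\ S g x]; split.
  suff -> : upper_density R F [set g | D g /\ S g x] = limn_esup (f ^~ x).
    rewrite deltaE; apply: le_trans deltax; apply: le_trans intL.
    rewrite le_eqVlt; apply/orP; left; apply/eqP; congr limn_esup.
    apply/funext => N; rewrite integral_average//.
    by congr average; apply/funext => g; rewrite integral_indic// setIT.
  congr limn_esup; apply/funext => N; rewrite /f average_indic.
  congr (#|` _|%:R / _)%:E; apply/fsetP => g; rewrite !inE.
  apply: andb_id2l => gF; apply/idP/idP; rewrite !inE; first by case.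
  by split=> //; exists N.
move=> _ [b [Db [bY _]] [b' [Db' [_ bY']] <-]] /=.
by rewrite (measure_action_split actT)//; exact: (meetx (b, b')).
Qed.
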